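(* Let $G$ be a finite graph. For any $\{0,1\}$-assigning $\alpha$ of $G$, if there exist a finite Abelian group $A$ and a locally zero-sum function $b\in Z(G,A)$ such that $\alpha=\alpha_{G,b}$, then the $\alpha$-assigning polynomial of $G$ satisfies \[ F(G,\alpha;k)=\sum_{\substack{S\subseteq E(G),\\ G-S \text{ is } b\text{-compatible}}}(-1)^{|S|}\,k^{m(G-S)}. \]
   Context: Graphs are finite with vertex set $V(G)$ and edge set $E(G)$; multiple edges and loops are allowed. $c(G)$ is the number of connected components of $G$ (a graph with no vertices has $0$ components) and $m(G)=|E(G)|-|V(G)|+c(G)$. For $S\subseteq E(G)$, $G-S$ is the spanning subgraph obtained by deleting the edges in $S$. For $X\subseteq V(G)$, $G[X]$ and $G-X$ are the vertex-induced subgraphs on $X$ and $V(G)\setminus X$. Let $A$ be a finite additive Abelian group. Fix an arbitrary edge orientation of $G$. For $v\in V(G)$ let $E^+(v)$ (resp. $E^-(v)$) be the set of edges whose head (resp. tail) is $v$ (a loop at $v$ belongs to both). The boundary of $f\in A^{E(G)}$ is $\partial f\in A^{V(G)}$, $\partial f(v)=\sum_{e\in E^+(v)}f(e)-\sum_{e\in E^-(v)}f(e)$. For $b\in A^{V(G)}$, an $(A,b)$-flow is an $f\in A^{E(G)}$ with $\partial f=b$; it is nowhere-zero if $f(e)\neq 0$ for all $e\in E(G)$. $F^*(G,b;A)$ is the number of nowhere-zero $(A,b)$-flows of $G$ (independent of the orientation). A function $b\in A^{V(G)}$ is locally zero-sum on a graph $H$ with vertex set $V(G)$ if $\sum_{v\in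 V(C)}b(v)=0$ for every connected component $C$ of $H$; in that case $H$ is called $b$-compatible. $Z(G,A)$ is the set of all $b\in A^{V(G)}$ that are locally zero-sum on $G$. $\Lambda(G)$ is the family of nonempty $X\subseteq V(G)$ such that $G[X]$ is connected and $c(G-X)=c(G)$. A $\{0,1\}$-assigning of $G$ is a map $\alpha:\Lambda(G)\to\{0,1\}$. Each $b\in A^{V(G)}$ induces the $\{0,1\}$-assigning $\alpha_{G,b}$ with $\alpha_{G,b}(X)=0$ if $\sum_{v\in X}b(v)=0$ and $\alpha_{G,b}(X)=1$ otherwise. By a theorem of Kochol, if $\alpha=\alpha_{G,b}$ for some finite Abelian group $A$ and $b\in Z(G,A)$, there is a (unique) polynomial $F(G,\alpha;k)$ in $k$, of degree at most $m(G)$, such that $F(G,\alpha;k)=F^*(G,b';A')$ for every Abelian group $A'$ of order $k$ and every $b'\in Z(G,A')$ with $\alpha_{G,b'}=\alpha$; it is called the $\alpha$-assigning polynomial of $G$. *)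

(* Defs.v *)
From HB Require Import structures.
From mathcomp Require Import all_boot all_order all_algebra.
Set Implicit Arguments.
Unset Strict Implicit.
Unset Printing Implicit Defensive.
Import Order.TTheory GRing.Theory Num.Theory.
Local Open Scope ring_scope.

(* A finite multigraph, loops allowed. The order of the two ends of an edge is
   the arbitrary reference orientation used for boundaries; adjacency, and
   hence everything about connectivity, ignores it. *)
Record mgraph := MGraph {
  vertex : finType;
  edge : finType;
  tail_of : edge -> vertex;
  head_of : edge -> vertex
}.

Arguments tail_of {G} e : rename.
Arguments head_of {G} e : rename.

Section Graphs.
Variable G : mgraph.

Definition adj : rel (vertex G) := fun u v =>
  [exists e : edge G, ((tail_of e == u) && (head_of e == v))
                   || ((tail_of e == v) && (head_of e == u))].

Definition connected : bool :=
  [forall u : vertex G, forall v : vertex G, connect adj u v].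

Definition components : {set {set vertex G}} :=
  equivalence_partition (connect adj) [set: vertex G].

Definition ncomp : nat := #|components|.

(* The subtraction of naturals is never truncated: #|V| <= #|E| + c(G). *)
Definition cyclomatic : nat := (#|edge G| + ncomp - #|vertex G|)%N.

Definition del_edges (S : {set edge G}) : mgraph :=
  @MGraph (vertex G) {e : edge G | e \notin S}
    (fun e => tail_of (val e)) (fun e => head_of (val e)).

Definition induced (X : {set vertex G}) : mgraph :=
  @MGraph {v : vertex G | v \in X}
    {e : edge G | (tail_of e \in X) && (head_of e \in X)}
    (fun e => exist _ (tail_of (val e)) (proj1 (andP (valP e))))
    (fun e => exist _ (head_of (val e)) (proj2 (andP (valP e)))).

Definition del_vertices (X : {set vertex G}) : mgraph := induced (~: X).

End Graphs.

Section Flows.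
Variables (G : mgraph) (A : finZmodType).
Implicit Types (f : {ffun edge G -> A}) (b : {ffun vertex G -> A}).

Definition boundary f : {ffun vertex G -> A} :=
  [ffun v => \sum_(e | head_of e == v) f e - \sum_(e | tail_of e == v) f e].

Definition is_flow b f : bool := boundary f == b.

Definition nowhere_zero f : bool := [forall e, f e != 0].

Definition nz_flow_count b : nat :=
  #|[set f : {ffun edge G -> A} | is_flow b f && nowhere_zero f]|.

Definition locally_zero_sum b : bool :=
  [forall C in components G, \sum_(v in C) b v == 0].

Definition zero_sum_functions : {set {ffun vertex G -> A}} :=
  [set b | locally_zero_sum b].

End Flows.

(* [del_edges G S] has the same vertex type as [G], so [b] is also a function
   on its vertices. *)
Definition compatible (G : mgraph) (A : finZmodType)
    (b : {ffun vertex G -> A}) (S : {set edge G}) : bool :=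
  @locally_zero_sum (del_edges S) A b.

Definition Lambda (G : mgraph) : {set {set vertex G}} :=
  [set X : {set vertex G} | [&& X != set0, connected (induced X)
                              & ncomp (del_vertices X) == ncomp G]].

(* The values 0 and 1 are encoded as [false] and [true]. *)
Definition assigning (G : mgraph) : Type :=
  {ffun {X : {set vertex G} | X \in Lambda G} -> bool}.

Definition induced_assigning (G : mgraph) (A : finZmodType)
    (b : {ffun vertex G -> A}) : assigning G :=
  [ffun X : {X : {set vertex G} | X \in Lambda G} => \sum_(v in val X) b v != 0].

(* The defining property of the alpha-assigning polynomial. For alpha induced
   by some locally zero-sum function, exactly one polynomial satisfies it. *)
Definition is_assigning_polynomial (G : mgraph) (alpha : assigning G)
    (F : {poly rat}) : Prop :=
  (size F <= (cyclomatic G).+1)%N /\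
  forall (A : finZmodType) (b : {ffun vertex G -> A}),
    b \in zero_sum_functions G A -> induced_assigning b = alpha ->
    F.[#|A|%:R] = (nz_flow_count b)%:R.

(* Main.v *)
Require Import Defs.
From HB Require Import structures.
From mathcomp Require Import all_boot all_order all_algebra.
Set Implicit Arguments.
Unset Strict Implicit.
Unset Printing Implicit Defensive.
Import Order.TTheory GRing.Theory Num.Theory.
Local Open Scope ring_scope.

(** The polynomial is what inclusion-exclusion over the set of edges on which a
    flow vanishes produces, once two facts are known.

    The first is the number of flows of a graph [H] with values in a group of
    order [k] and prescribed boundary [b]: it is [k ^ m(H)] if [b] sums to zero
    on every component of [H], and [0] otherwise ([card_flows]). The boundary
    map is additive, and its image is exactly the group of locally zero-sum
    functions: telescoping along a path realizes every function that carries
    mass from one vertex to another of the same component. That group has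
    order [k ^ (|V| - c)], because the map that sends a function to its sums
    over the components is onto; all fibres of the boundary map have the size
    of its kernel, so counting the domain gives the exponent. As flows of
    [G - S] are the flows of [G] that vanish on [S], inclusion-exclusion
    ([nz_flow_countE]) gives the formula for the boundary [b] itself.

    The second is that the index set of the sum depends on the assigning of [b]
    only ([assigning_compatible]). Let [C] be a component of [G - S]; in general
    [C] is not in [Lambda G]. But if [D] is a component of [G - C] that is
    joined to [C], then [D] is in [Lambda G], because every path through [D] can
    be rerouted through the connected set [C] ([Lambda_piece]). Such a [D] is a
    union of components of [G - S], so a compatible [b] sums to zero on it, and
    so does every [b'] with the same assigning. The other components of [G - C]
    are components of [G]. Hence [b'] sums to zero outside [C], and therefore
    also on [C].

    Uniqueness holds because pairing [b] with zero in [A * Z/n] preserves the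
    assigning, so that the values at all multiples of [#|A|] are prescribed. *)

(** * Fibres of additive maps *)

Section Fibres.
Variables (I J : finType) (A : finZmodType).
Variable phi : {ffun I -> A} -> {ffun J -> A}.
Hypothesis phiB : {morph phi : x y / x - y}.

Lemma card_fibre x0 :
  #|[set x | phi x == phi x0]| = #|[set x | phi x == 0]|.
Proof.
rewrite -[RHS](card_imset _ (addIr x0)); apply: eq_card => x.
apply/idP/imsetP; rewrite inE.
  move=> /eqP phix; exists (x - x0); last by rewrite subrK.
  by rewrite inE phiB phix subrr.
case=> z; rewrite inE => /eqP phiz ->.
by rewrite -subr_eq0 -phiB addrK phiz.
Qed.

Lemma card_kernel_image (Im : {set {ffun J -> A}}) :
    (forall x, phi x \in Im) -> (forall y, y \in Im -> exists x, phi x = y) ->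
  (#|[set x | phi x == 0%R]| * #|Im| = #|A| ^ #|I|)%N.
Proof.
move=> phi_Im Im_phi; rewrite -card_ffun -[RHS]sum1_card.
rewrite (partition_big phi (mem Im)) //= mulnC -sum_nat_const.
by apply: eq_bigr => y /Im_phi [x0 <-]; rewrite -(card_fibre x0) sum1dep_card.
Qed.

End Fibres.

(** * Components and zero-sum functions *)

Lemma connect_map (T T' : finType) (e : rel T) (e' : rel T') (r : T -> T') :
    (forall x y, e x y -> connect e' (r x) (r y)) ->
  forall x y, connect e x y -> connect e' (r x) (r y).
Proof.
move=> e_r x _ /connectP [p e_p ->].
elim: p x e_p => [|z p IHp] x //= /andP [/e_r xz /IHp]; exact: connect_trans.
Qed.

Lemma connect_equivalence (T : finType) (e : rel T) (D : {set T}) :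
  symmetric e -> {in D & &, equivalence_rel (connect e)}.
Proof.
move=> sym_e x y z _ _ _; split=> // xy.
exact: (same_connect (sym_connect_sym sym_e) xy).
Qed.

Section Components.
Variable G : mgraph.

Lemma adj_sym : symmetric (@adj G).
Proof. by move=> u v; apply: eq_existsb => e; rewrite orbC. Qed.

Lemma adj_edge (e : edge G) : adj (tail_of e) (head_of e).
Proof. by apply/existsP; exists e; rewrite !eqxx. Qed.

Definition component (v : vertex G) : {set vertex G} :=
  [set u | connect (@adj G) v u].

Lemma componentsE : components G = [set component v | v in [set: vertex G]].
Proof.
by apply: eq_imset => v; apply/setP => u; rewrite !inE.
Qed.

Lemma component_in v : component v \in components G.
Proof. by rewrite componentsE imset_f. Qed.

Lemma componentsP C : reflect (exists v, C = component v) (C \in components G).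
Proof.
rewrite componentsE; apply: (iffP imsetP) => [[v _ ->]|[v ->]]; by exists v.
Qed.

Lemma component_eq u v : connect (@adj G) u v -> component u = component v.
Proof.
move=> uv; apply/setP => w; rewrite !inE.
exact: (same_connect (sym_connect_sym adj_sym)).
Qed.

Lemma component_closed C u v :
  C \in components G -> connect (@adj G) u v -> (u \in C) = (v \in C).
Proof.
move=> /componentsP [w ->] uv; rewrite !inE.
exact: (same_connect_r (sym_connect_sym adj_sym)).
Qed.

Lemma components_partition : partition (components G) [set: vertex G].
Proof. exact/equivalence_partitionP/connect_equivalence/adj_sym. Qed.

(** A set closed under adjacency is a union of components. *)
Lemma closed_zero_sum (A : finZmodType) (b : {ffun vertex G -> A})
    (X : {set vertex G}) :
    locally_zero_sum b ->
    (forall u v, adj u v -> (u \in X) = (v \in X)) ->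
  \sum_(v in X) b v = 0.
Proof.
move=> /forall_inP b0 clX; pose P v := v \in X.
rewrite (eq_bigl (fun v => (v \in [set: vertex G]) && P v)); last first.
  by move=> v; rewrite inE.
rewrite (set_partition_big_cond _ components_partition) big1 // => C CG.
have [w Cw] := componentsP _ CG.
have clXc u v : connect (@adj G) u v -> (u \in X) = (v \in X).
  by apply: closed_connect => x y; apply: clX.
have CX v : v \in C -> P v = P w by rewrite Cw inE => /clXc; rewrite /P.
case Pw: (P w).
  rewrite (eq_bigl (mem C)); first exact/eqP/b0.
  by move=> v /=; apply/andb_idr => /CX ->.
by rewrite big1 // => v /andP [/CX -> ]; rewrite Pw.
Qed.

End Components.
Arguments component {G} v.

(** * The number of flows with prescribed boundary *)

Section FlowCount.
Variables (G : mgraph) (A : finZmodType).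
Implicit Types (f : {ffun edge G -> A}) (b : {ffun vertex G -> A}).

Lemma boundaryB : {morph @boundary G A : f g / f - g}.
Proof.
move=> f g; apply/ffunP => v; rewrite !ffunE.
under eq_bigr do rewrite !ffunE.
rewrite big_split /= sumrN.
under [X in _ - X]eq_bigr do rewrite !ffunE.
by rewrite big_split /= sumrN !opprD !opprK addrACA.
Qed.

Lemma sum_boundary f (X : {set vertex G}) :
  \sum_(v in X) boundary f v =
  \sum_(e | head_of e \in X) f e - \sum_(e | tail_of e \in X) f e.
Proof.
under eq_bigr do rewrite ffunE.
rewrite big_split /= sumrN; congr (_ - _).
  rewrite (partition_big (@head_of G) (mem X)) //=; apply: eq_bigr => v vX.
  by apply: eq_bigl => e; apply/esym/andb_idl => /eqP ->.
rewrite (partition_big (@tail_of G) (mem X)) //=; apply: eq_bigr => v vX.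
by apply: eq_bigl => e; apply/esym/andb_idl => /eqP ->.
Qed.

Lemma boundary_locally_zero_sum f : locally_zero_sum (boundary f).
Proof.
apply/forall_inP => C CG; rewrite sum_boundary subr_eq0; apply/eqP.
apply: eq_bigl => e; apply/esym/component_closed => //.
exact/connect1/adj_edge.
Qed.

Definition point_mass (v : vertex G) (a : A) : {ffun vertex G -> A} :=
  [ffun w => if w == v then a else 0].

Definition is_boundary b := exists f, boundary f = b.

Lemma is_boundary0 : is_boundary 0.
Proof. by exists 0; rewrite -(subrr 0) boundaryB subrr. Qed.

Lemma is_boundaryB b1 b2 :
  is_boundary b1 -> is_boundary b2 -> is_boundary (b1 - b2).
Proof. by move=> [f1 <-] [f2 <-]; exists (f1 - f2); rewrite boundaryB. Qed.

Lemma is_boundaryD b1 b2 :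
  is_boundary b1 -> is_boundary b2 -> is_boundary (b1 + b2).
Proof.
move=> B1 B2; rewrite -[b2]opprK; apply: is_boundaryB => //.
by rewrite -[- b2]add0r; apply: is_boundaryB => //; apply: is_boundary0.
Qed.

Lemma is_boundary_sum (I : finType) (F : I -> {ffun vertex G -> A}) :
  (forall i, is_boundary (F i)) -> is_boundary (\sum_i F i).
Proof.
move=> BF; apply: (big_ind is_boundary) => //; first exact: is_boundary0.
exact: is_boundaryD.
Qed.

Lemma is_boundary_edge (e : edge G) a :
  is_boundary (point_mass (head_of e) a - point_mass (tail_of e) a).
Proof.
have sum_e v (end_of : edge G -> vertex G) :
    \sum_(e' | end_of e' == v) [ffun e' => if e' == e then a else 0] e' =
    point_mass (end_of e) a v.
  rewrite ffunE (eq_sym v); under eq_bigr do rewrite ffunE.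
  rewrite -big_mkcondr /=; case: eqP => [ev | ne].
    rewrite (big_pred1 e) // => e'; apply/andb_idl => /eqP ->; exact/eqP.
  by rewrite big1 // => e' /andP [/eqP ev /eqP ee']; case: ne; rewrite -ee'.
exists [ffun e' => if e' == e then a else 0].
by apply/ffunP => v; rewrite [LHS]ffunE [RHS]ffunE [X in _ = _ + X]ffunE !sum_e.
Qed.

(** Telescoping along a path from [u] to [v]; an edge traversed against its
    orientation contributes the opposite of its boundary. *)
Lemma is_boundary_path u v a :
  connect (@adj G) u v -> is_boundary (point_mass v a - point_mass u a).
Proof.
case/connectP => p; elim: p u => [|w p IHp] u /=.
  by move=> _ ->; rewrite subrr; apply: is_boundary0.
case/andP => /existsP [e uw] /IHp {}IHp /IHp {}IHp.
rewrite -(subrK (point_mass w a) (point_mass v a)) -addrA.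
apply: is_boundaryD => //.
case/orP: uw => /andP [/eqP <- /eqP <-]; first exact: is_boundary_edge.
rewrite -opprB -sub0r; apply: is_boundaryB; first exact: is_boundary0.
exact: is_boundary_edge.
Qed.

(** Moving the value at each vertex from a root of its component to the vertex
    itself costs a boundary, and what is left at the root is the sum over the
    component, which is zero. *)
Lemma zero_sum_is_boundary b : locally_zero_sum b -> is_boundary b.
Proof.
move=> /forall_inP b0; pose r := fingraph.root (@adj G).
have rv v : connect (@adj G) (r v) v.
  by rewrite (sym_connect_sym (@adj_sym G)) connect_root.
suff -> : b = \sum_v (point_mass v (b v) - point_mass (r v) (b v)).
  by apply: is_boundary_sum => v; apply: is_boundary_path.
apply/ffunP => w; rewrite sum_ffunE.
under eq_bigr do rewrite ffunE [X in _ + X]ffunE ffunE [X in _ - X]ffunE.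
rewrite big_split /= sumrN -!big_mkcond /= (big_pred1 w) => [|v]; last first.
  exact: eq_sym.
(* What remains is the mass collected at [w]: nothing unless [w] is a root, and
   otherwise the sum over its component. *)
rewrite [X in _ - X](_ : _ = 0) ?subr0 //.
have sym_adj := sym_connect_sym (@adj_sym G).
have [rw | nrw] := eqVneq (r w) w; last first.
  by apply: big1 => v /eqP wr; case/eqP: nrw; rewrite wr /r root_root.
rewrite -[RHS](eqP (b0 _ (component_in w))); apply: eq_bigl => v.
by rewrite inE -(root_connect sym_adj) -/(r w) -/(r v) rw.
Qed.

(** The right side counts the domain of the map from functions to their sums
    over the components: the locally zero-sum functions are its kernel, and it
    is onto because a value can be put at the root of each component. *)
Lemma card_zero_sum :
  (#|zero_sum_functions G A| * #|A| ^ ncomp G = #|A| ^ #|vertex G|)%N.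
Proof.
pose J : finType := {C : {set vertex G} | C \in components G}.
pose phi b : {ffun J -> A} := [ffun C : J => \sum_(v in val C) b v].
have phiB : {morph phi : b1 b2 / b1 - b2}.
  move=> b1 b2; apply/ffunP => C; rewrite !ffunE -sumrB.
  by apply: eq_bigr => v _; rewrite !ffunE.
have <- : #|[set: {ffun J -> A}]| = (#|A| ^ ncomp G)%N.
  by rewrite cardsT card_ffun card_sig.
rewrite -(card_kernel_image phiB (Im := setT)) => [|b|y _]; last 2 first.
- by rewrite inE.
- exists [ffun v => if fingraph.root (@adj G) v == v
                    then y (Sub (component v) (component_in v)) else 0].
  apply/ffunP => C; rewrite ffunE.
  have [w Cw] := componentsP _ (valP C).
  pose r := fingraph.root (@adj G) w.
  have wr : connect (@adj G) w r by apply: connect_root.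
  rewrite (bigD1 r) /=; last by rewrite Cw inE.
  rewrite big1 => [|v /andP [vC vr]]; last first.
    rewrite ffunE; case: eqP => // rv; case/eqP: vr; rewrite -rv /r.
    apply/esym/(fingraph.rootP (sym_connect_sym (@adj_sym G))).
    by move: vC; rewrite Cw inE.
  rewrite addr0 ffunE root_root ?eqxx; last exact/sym_connect_sym/adj_sym.
  congr (y _); apply: val_inj; rewrite SubK Cw.
  exact/esym/component_eq.
congr (_ * _)%N; apply: eq_card => b; rewrite !inE.
apply/forall_inP/eqP => [b0 | /ffunP b0 C CG].
  by apply/ffunP => C; rewrite !ffunE; apply/eqP/b0/valP.
by have := b0 (Sub C CG); rewrite !ffunE SubK => ->.
Qed.

Lemma card_cycles :
  (#|[set f : {ffun edge G -> A} | boundary f == 0%R]| * #|A| ^ #|vertex G|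
   = #|A| ^ (#|edge G| + ncomp G))%N.
Proof.
rewrite -card_zero_sum mulnA expnD; congr (_ * _)%N.
apply: (card_kernel_image boundaryB) => [f|b]; rewrite inE.
  exact: boundary_locally_zero_sum.
exact: zero_sum_is_boundary.
Qed.

End FlowCount.

(** Read off from the count of cycles over a group of order two, whose kernel
    factor is at least one; over a trivial group the count says nothing. *)
Lemma vertex_bound (G : mgraph) : (#|vertex G| <= #|edge G| + ncomp G)%N.
Proof.
rewrite -(@leq_exp2l 2) // -[2%N]card_ord -card_cycles.
rewrite leq_pmull // card_gt0; apply/set0Pn; exists 0.
by rewrite inE -(subrr 0) boundaryB subrr.
Qed.

Lemma card_flows (G : mgraph) (A : finZmodType) (b : {ffun vertex G -> A}) :
  #|[set f | is_flow b f]| =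
  (if locally_zero_sum b then #|A| ^ cyclomatic G else 0)%N.
Proof.
case: ifP => [/zero_sum_is_boundary [f0 <-] | nb].
  rewrite [LHS](card_fibre (@boundaryB G A)).
  have A_gt0 : (0 < #|A| ^ #|vertex G|)%N.
    by rewrite expn_gt0; apply/orP; left; apply/card_gt0P; exists 0.
  apply/eqP; rewrite -(eqn_pmul2r A_gt0) card_cycles -expnD.
  by rewrite subnK // vertex_bound.
apply/eqP; rewrite cards_eq0; apply/set0Pn => -[f]; rewrite inE => /eqP fb.
by rewrite -fb boundary_locally_zero_sum in nb.
Qed.

(** * Inclusion-exclusion over the vanishing edges *)

Section DeletedEdges.
Variables (G : mgraph) (A : finZmodType) (S : {set edge G}).
Implicit Types (b : {ffun vertex G -> A}).

Definition extend_zero (g : {ffun edge (del_edges S) -> A}) :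
    {ffun edge G -> A} := [ffun e => oapp g 0 (insub e)].

Lemma extend_zero_val g (e : edge (del_edges S)) : extend_zero g (val e) = g e.
Proof. by rewrite ffunE valK. Qed.

Lemma extend_zero_deleted g e : e \in S -> extend_zero g e = 0.
Proof. by move=> eS; rewrite ffunE insubF //= eS. Qed.

Lemma extend_zero_inj : injective extend_zero.
Proof.
by move=> g h gh; apply/ffunP => e; rewrite -!extend_zero_val gh.
Qed.

Lemma boundary_extend_zero g :
  boundary (extend_zero g) = @boundary (del_edges S) A g
    :> {ffun vertex G -> A}.
Proof.
have sum_kept (P : pred (edge G)) :
    \sum_(e | P e) extend_zero g e =
    \sum_(e : edge (del_edges S) | P (val e)) g e.
  rewrite (bigID (fun e => e \in S)) /= big1 ?add0r; last first.
    by move=> e /andP [_ eS]; apply: extend_zero_deleted.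
  under eq_bigl do rewrite andbC.
  rewrite (big_sub_cond (fun e => e \notin S) P).
  by apply: eq_bigr => e _; apply: extend_zero_val.
by apply/ffunP => v; rewrite !ffunE !sum_kept.
Qed.

Lemma card_flows_vanishing b :
  #|[set f | is_flow b f & [forall e in S, f e == 0]]| =
  #|[set g | @is_flow (del_edges S) A b g]|.
Proof.
rewrite -(card_imset _ extend_zero_inj); apply: eq_card => f.
rewrite inE; apply/andP/imsetP => [[fb /forall_inP f0]|[g gb ->]]; last first.
  split; last by apply/forall_inP => e eS; rewrite extend_zero_deleted.
  by rewrite inE in gb; rewrite /is_flow boundary_extend_zero.
have fE : f = extend_zero [ffun e => f (val e)].
  apply/ffunP => e; have [eS | eS] := boolP (e \in S).
    by rewrite extend_zero_deleted //; apply/eqP/f0.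
  pose e' : edge (del_edges S) := exist _ e eS.
  by rewrite -[e]/(val e') extend_zero_val ffunE.
exists [ffun e => f (val e)] => //.
by rewrite inE /is_flow -boundary_extend_zero -fE.
Qed.

End DeletedEdges.

(** Cycles of [G - S] extend by zero to cycles of [G]; over a group of order two
    their numbers are powers of two with the cyclomatic numbers as exponents. *)
Lemma cyclomatic_del_edges (G : mgraph) (S : {set edge G}) :
  (cyclomatic (del_edges S) <= cyclomatic G)%N.
Proof.
have card2 : #|'I_2| = 2%N := card_ord 2.
have zero_sum0 (H : mgraph) : locally_zero_sum (0 : {ffun vertex H -> 'I_2}).
  by rewrite -(subrr (boundary 0)) -boundaryB boundary_locally_zero_sum.
rewrite -(@leq_exp2l 2) // -[2%N]card2.
have := card_flows (0 : {ffun vertex G -> 'I_2}).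
have := @card_flows (del_edges S) 'I_2 0.
rewrite !zero_sum0 -card_flows_vanishing => <- <-.
by apply/subset_leq_card/subsetP => f; rewrite !inE => /andP [].
Qed.

(** The indicator of being nowhere zero is the product over the edges of
    [1 - (f e == 0)]; expanding it makes [S] the set of edges at which the
    second term is chosen. *)
Lemma nz_flow_countE (G : mgraph) (A : finZmodType) (b : {ffun vertex G -> A}) :
  (nz_flow_count b)%:R =
  \sum_(S : {set edge G} | compatible b S)
     (-1) ^+ #|S| * #|A|%:R ^+ cyclomatic (del_edges S) :> rat.
Proof.
transitivity (\sum_(f | is_flow b f) \prod_e (1 - (f e == 0)%:R) : rat).
  rewrite /nz_flow_count cardsE -sum1_card natr_sum.
  rewrite big_mkcondr /=; apply: eq_bigr => f _.
  case: ifPn => [/forallP nz | ].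
    by rewrite big1 // => e _; rewrite (negbTE (nz e)) subr0.
  rewrite negb_forall => /existsP [e /negPn fe].
  by rewrite (bigD1 e) //= fe subrr mul0r.
under eq_bigr => f _.
  rewrite (eq_bigr (fun e => - (f e == 0)%:R + 1)); last first.
    by move=> e _; rewrite addrC.
  rewrite bigA_distr.
  over.
rewrite exchange_big /= [RHS]big_mkcond /=; apply: eq_bigr => S _.
pose vanishing := [set f | is_flow b f & [forall e in S, f e == 0]].
transitivity ((-1) ^+ #|S| * #|vanishing|%:R : rat).
  rewrite -[in RHS]sum1dep_card natr_sum mulr_sumr [RHS]big_mkcondr.
  apply: eq_bigr => f _; rewrite -big_mkcond prodrN.
  case: ifPn => [/forall_inP f0 | ].
    by rewrite big1 // => e /f0 ->.
  rewrite negb_forall_in => /exists_inP [e eS fe].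
  by rewrite (bigD1 e) //= (negbTE fe) mul0r mulr0.
rewrite card_flows_vanishing card_flows /compatible.
by case: ifP => _; rewrite ?mulr0 ?natrX.
Qed.

(** * Compatibility depends on the assigning only *)

Lemma ncomp_eq (H G : mgraph) (i : vertex H -> vertex G) :
    (forall u v, connect (@adj H) u v = connect (@adj G) (i u) (i v)) ->
    (forall x, exists u, connect (@adj G) (i u) x) ->
  ncomp H = ncomp G.
Proof.
move=> i_conn i_onto.
have pre_comp u : i @^-1: component (i u) = component u.
  by apply/setP => v; rewrite !inE i_conn.
have comp_i K : K \in components G -> exists u, K = component (i u).
  move=> /componentsP [x ->]; have [u /component_eq <-] := i_onto x.
  by exists u.
have -> : ncomp H = #|[set i @^-1: (K : {set vertex G}) | K in components G]|.
  apply: eq_card => L.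
  apply/componentsP/imsetP => [[u ->]|[K /comp_i [u ->] ->]].
    by exists (component (i u)); rewrite ?pre_comp ?component_in.
  by exists u.
rewrite card_in_imset // => _ _ /comp_i [u ->] /comp_i [v ->].
rewrite !pre_comp => /setP /(_ v); rewrite !inE connect0 i_conn.
exact: component_eq.
Qed.

Section Detour.
Variable G : mgraph.
Implicit Types (C X : {set vertex G}).

Lemma adj_induced X (x y : vertex (induced X)) :
  adj x y = adj (val x) (val y).
Proof.
apply/existsP/existsP => -[e He].
  by exists (val e); move: He; rewrite -!val_eqE.
have eX : (tail_of e \in X) && (head_of e \in X).
  case/orP: He => /andP [/eqP -> /eqP ->]; apply/andP; split; exact: valP.
by exists (exist _ e eX); rewrite -!val_eqE.
Qed.

Definition adj_avoiding C : rel (vertex G) :=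
  fun u v => [&& adj u v, u \notin C & v \notin C].

Lemma adj_avoiding_sym C : symmetric (adj_avoiding C).
Proof.
by move=> u v; rewrite /adj_avoiding adj_sym [(u \notin _) && _]andbC.
Qed.

(** For [v] outside [C], the vertex set of the component of [G - C] containing
    [v], taken inside [vertex G] rather than in the type of vertices of the
    induced subgraph. *)
Definition piece C v : {set vertex G} :=
  [set w in ~: C | connect (adj_avoiding C) v w].

Lemma piece_disjoint C v w : w \in piece C v -> w \notin C.
Proof. by rewrite !inE => /andP []. Qed.

Lemma piece_closed C v x y :
  adj x y -> x \notin C -> y \notin C -> (x \in piece C v) = (y \in piece C v).
Proof.
move=> xy xC yC; rewrite !inE xC yC /=.
apply: (same_connect_r (sym_connect_sym (@adj_avoiding_sym C))).
by apply: connect1; rewrite /adj_avoiding xy xC.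
Qed.

Lemma piece_connected C v : connected (induced (piece C v)).
Proof.
have sym := sym_connect_sym (@adj_avoiding_sym C).
apply/forallP => x; apply/forallP => y.
rewrite -[x](valKd x) -[y in connect _ _ y](valKd x).
apply: (connect_map (e := adj_avoiding C)) => [s t /and3P [st sC tC]|].
  have stD := piece_closed v st sC tC.
  case sD: (s \in piece C v); rewrite sD in stD.
    by apply: connect1; rewrite adj_induced !insubdK.
  by rewrite /insubd !insubF.
have:= valP x; have:= valP y; rewrite !inE => /andP [_ vy] /andP [_ vx].
by rewrite -(same_connect sym vx).
Qed.

(** With [D] for the piece, sending all of [D] to the single vertex [c] of [C]
    turns a walk of [G] into one of [G - D], up to detours inside [C]: an edge
    that leaves [D] ends in [C], where [c] can be reached. So [G] and [G - D]
    have the same connectivity outside [D], and the component of [G] containing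
    [D] survives since it contains [c]. *)
Lemma Lambda_piece C v c d :
    connected (induced C) -> c \in C -> d \in piece C v -> adj c d ->
  piece C v \in Lambda G.
Proof.
set D := piece C v => /forallP C_conn cC dD cd.
have symG := sym_connect_sym (@adj_sym G).
have CD u : u \in C -> u \in ~: D.
  by move=> uC; rewrite inE; apply/negP => /piece_disjoint; rewrite uC.
pose H := del_vertices D.
pose c0 : vertex H := Sub c (CD c cC).
have C_connH u (uC : u \in C) : connect (@adj H) c0 (Sub u (CD u uC)).
  have /forallP /(_ (Sub u uC)) := C_conn (Sub c cC).
  pose r (x : vertex (induced C)) : vertex H := Sub (val x) (CD _ (valP x)).
  move=> /(connect_map (r := r) (e' := @adj H)) conn_r.
  have -> : c0 = r (Sub c cC) by apply: val_inj.
  have -> : Sub u (CD u uC) = r (Sub u uC) by apply: val_inj.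
  apply: conn_r => x y; rewrite adj_induced => xy.
  by apply: connect1; rewrite adj_induced.
pose r x : vertex H := insubd c0 x.
have step x y :
    adj x y -> x \in D -> y \notin D -> connect (@adj H) (r x) (r y).
  move=> xy xD yD.
  have yC : y \in C.
    apply: contraR yD => yC.
    by rewrite -(piece_closed v xy) // (piece_disjoint xD).
  have -> : r x = c0 by rewrite /r /insubd insubF // inE xD.
  have -> : r y = Sub y (CD y yC) by apply: val_inj; rewrite insubdK // CD.
  exact: C_connH.
rewrite inE; apply/and3P; split; last 2 first.
- exact: piece_connected.
- apply/eqP/(ncomp_eq (i := val : vertex H -> vertex G)) => [u w|x].
    apply/idP/idP.
      by apply: connect_map => x y; rewrite adj_induced; apply: connect1.
    rewrite -{2}[u](valKd c0) -{2}[w](valKd c0) -!/(r _).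
    apply: connect_map => x y xy.
    have [xD | xD] := boolP (x \in D); have [yD | yD] := boolP (y \in D).
    + by rewrite /r /insubd !insubF // inE ?xD ?yD.
    + exact: step.
    + rewrite (sym_connect_sym (@adj_sym H)); apply: step => //.
      by rewrite adj_sym.
    + by apply: connect1; rewrite adj_induced !insubdK // inE.
  have [xD | xD] := boolP (x \in D); last first.
    have xD' : x \in ~: D by rewrite inE.
    by exists (Sub x xD').
  exists c0; apply: connect_trans (connect1 cd) _.
  have sub_avoid : subrel (connect (adj_avoiding C)) (connect (@adj G)).
    by apply: connect_sub => s t /andP [/connect1].
  move: dD xD; rewrite !inE => /andP [_ /sub_avoid vd] /andP [_ /sub_avoid vx].
  by rewrite -(same_connect symG vd).
- by apply/set0Pn; exists d.
Qed.

End Detour.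

Lemma adj_del_edges (G : mgraph) (S : {set edge G}) (u v : vertex G) :
  @adj (del_edges S) u v -> @adj G u v.
Proof. by case/existsP => e uv; apply/existsP; exists (val e); apply: uv. Qed.

Lemma component_connected (G : mgraph) (S C : {set _}) :
  C \in components (del_edges S) -> connected (@induced G C).
Proof.
move=> CH; apply/forallP => x; apply/forallP => y.
rewrite -[x](valKd x) -[y in connect _ _ y](valKd x).
apply: (connect_map (e := @adj (del_edges S))) => [s t st|].
  have stC := component_closed CH (connect1 st).
  case sC: (s \in C); rewrite sC in stC.
    apply: connect1; rewrite adj_induced !insubdK //.
    exact: adj_del_edges st.
  by rewrite /insubd !insubF.
have [v Cv] := componentsP _ CH.
have inC z : z \in C -> connect (@adj (del_edges S)) v z by rewrite Cv inE.
rewrite -(same_connect (sym_connect_sym (@adj_sym (del_edges S)))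
                       (inC _ (valP x))).
exact/inC/valP.
Qed.

(** The sum over all vertices vanishes, so it is enough to treat the complement
    of [C], piece by piece: a piece joined to [C] is in [Lambda G], any other
    piece is closed under adjacency in the whole graph. *)
Lemma sum_connected_set (G : mgraph) (A : finZmodType)
    (b : {ffun vertex G -> A}) (C : {set vertex G}) :
    locally_zero_sum b -> connected (induced C) ->
    (forall v, piece C v \in Lambda G -> \sum_(w in piece C v) b w = 0) ->
  \sum_(v in C) b v = 0.
Proof.
move=> b0 C_conn Lambda_b.
have sumV : \sum_v b v = 0.
  rewrite -[RHS](closed_zero_sum (X := setT) b0) => [|u v _]; last first.
    by rewrite !inE.
  by apply: eq_bigl => v; rewrite inE.
rewrite (bigID (mem C)) /= in sumV.
suff out0 : \sum_(v | v \notin C) b v = 0 by rewrite out0 addr0 in sumV.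
rewrite (eq_bigl (mem (~: C))); last by move=> v; rewrite /= inE.
have parts := connect_equivalence (D := ~: C) (@adj_avoiding_sym G C).
rewrite (set_partition_big _ (equivalence_partitionP parts)) big1 // => D.
case/imsetP => v vC ->{D}; rewrite -/(piece C v).
have [/exists_inP [c cC /exists_inP [d dD cd]]|no_edge] :=
  boolP [exists c in C, [exists d in piece C v, adj c d]].
  exact/Lambda_b/(Lambda_piece C_conn cC dD cd).
have C_D x y : x \in C -> adj x y -> (x \in piece C v) = (y \in piece C v).
  move=> xC xy; have -> : (x \in piece C v) = false.
    by apply/negbTE/negP => /piece_disjoint; rewrite xC.
  apply/esym/negbTE; apply: contra no_edge => yD.
  by apply/exists_inP; exists x => //; apply/exists_inP; exists y.
apply: (closed_zero_sum b0) => x y xy.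
have [xC | xC] := boolP (x \in C); first exact: C_D.
have [yC | yC] := boolP (y \in C); last exact: piece_closed.
by apply/esym/C_D; rewrite // adj_sym.
Qed.

Lemma piece_closed_component (G : mgraph) (S : {set edge G})
    (C : {set vertex G}) (v x y : vertex G) :
    C \in components (del_edges S) -> @adj (del_edges S) x y ->
  (x \in piece C v) = (y \in piece C v).
Proof.
move=> CH xy; have xyC : (x \in C) = (y \in C).
  exact: component_closed CH (connect1 xy).
have [xC | xC] := boolP (x \in C); last first.
  by apply: (piece_closed v (adj_del_edges xy) xC); rewrite -xyC.
have yC : y \in C by rewrite -xyC.
by apply/idP/idP => /piece_disjoint; rewrite ?xC ?yC.
Qed.

(** Each piece of the complement of a component of [G - S] is closed under
    adjacency in [G - S], so [b] sums to zero on it. *)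
Lemma compatible_transfer (G : mgraph) (A A' : finZmodType)
    (b : {ffun vertex G -> A}) (b' : {ffun vertex G -> A'}) (S : {set edge G}) :
    locally_zero_sum b' ->
    (forall X, X \in Lambda G ->
       \sum_(v in X) b v = 0 -> \sum_(v in X) b' v = 0) ->
  compatible b S -> compatible b' S.
Proof.
move=> b'0 Lambda_b b0; apply/forall_inP => C CH; apply/eqP.
apply: (sum_connected_set b'0 (component_connected CH)) => v vD.
apply: Lambda_b => //; apply: (closed_zero_sum b0) => x y.
exact: piece_closed_component CH.
Qed.

Lemma assigning_compatible (G : mgraph) (A A' : finZmodType)
    (b : {ffun vertex G -> A}) (b' : {ffun vertex G -> A'}) :
    locally_zero_sum b -> locally_zero_sum b' ->
    induced_assigning b = induced_assigning b' ->
  compatible b =1 compatible b'.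
Proof.
move=> b0 b'0 /ffunP bb' S.
have sumE X : X \in Lambda G ->
    (\sum_(v in X) b v == 0) = (\sum_(v in X) b' v == 0).
  by move=> XL; have := bb' (Sub X XL); rewrite !ffunE SubK => /negb_inj.
apply/idP/idP; apply: compatible_transfer => // X /sumE bX /eqP.
  by rewrite bX => /eqP.
by rewrite -bX => /eqP.
Qed.

(** * Uniqueness *)

HB.instance Definition _ (A B : finZmodType) := Finite.on (A * B)%type.

Lemma poly_eq_evals (p q : {poly rat}) (x : nat -> rat) :
  injective x -> (forall n, p.[x n] = q.[x n]) -> p = q.
Proof.
move=> x_inj pq; apply/eqP; rewrite -subr_eq0; apply/contraT => pq0.
have := max_poly_roots pq0 (rs := map x (iota 0 (size (p - q)))).
rewrite size_map size_iota ltnn => -> //; last first.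
  by rewrite map_inj_uniq ?iota_uniq.
by apply/allP => _ /mapP [n _ ->]; rewrite /root !hornerE pq subrr.
Qed.

Definition product_left (G : mgraph) (A B : finZmodType)
  (b : {ffun vertex G -> A}) : {ffun vertex G -> (A * B)%type} :=
  [ffun v => (b v, 0)].

Lemma sum_product_left (G : mgraph) (A B : finZmodType)
    (b : {ffun vertex G -> A}) (X : {set vertex G}) :
  (\sum_(v in X) product_left B b v == 0) = (\sum_(v in X) b v == 0).
Proof.
have -> : \sum_(v in X) product_left B b v = (\sum_(v in X) b v, 0).
  apply: (big_ind2 (fun p a => p = (a, 0))) => // [_ a1 _ a2 -> ->|v _].
    by congr (_, _); rewrite addr0.
  by rewrite ffunE.
by apply/eqP/eqP => [/(congr1 fst) | ->].
Qed.

Theorem theorem1p3 (G : mgraph) (alpha : assigning G)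
    (A : finZmodType) (b : {ffun vertex G -> A})
    (hb : b \in zero_sum_functions G A)
    (halpha : alpha = induced_assigning b) :
  unique (is_assigning_polynomial alpha)
    (\sum_(S : {set edge G} | compatible b S)
       (-1) ^+ #|S| *: 'X^(cyclomatic (del_edges S))).
Proof.
rewrite inE in hb; set P := \sum_(S | _) _.
have P_counts (A' : finZmodType) (b' : {ffun vertex G -> A'}) :
    b' \in zero_sum_functions G A' -> induced_assigning b' = alpha ->
    P.[#|A'|%:R] = (nz_flow_count b')%:R.
  rewrite inE => b'0; rewrite halpha => bb'.
  rewrite nz_flow_countE horner_sum.
  apply: eq_big => [S|S _]; last by rewrite hornerZ hornerXn.
  by rewrite (assigning_compatible b'0 hb bb').
split.
  split=> //; apply: (leq_trans (size_sum _ _ _)); apply/bigmax_leqP => S _.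
  apply: leq_trans (size_scale_leq _ _) _.
  by rewrite size_polyXn ltnS cyclomatic_del_edges.
move=> F [_ F_counts].
(* The points of evaluation are the orders of [A * Z/(n+1)]. *)
apply: (poly_eq_evals (x := fun n => (#|A| * n.+1)%:R)) => [m n /eqP|n].
  have A_gt0 : (0 < #|A|)%N by apply/card_gt0P; exists 0.
  by rewrite eqr_nat eqn_pmul2l // eqSS => /eqP.
pose B : finZmodType := 'I_n.+1.
have -> : (#|A| * n.+1 = #|{: A * B}|)%N by rewrite card_prod card_ord.
have b'0 : product_left B b \in zero_sum_functions G (A * B)%type.
  rewrite inE; apply/forall_inP => C CG; rewrite sum_product_left.
  exact: (forall_inP hb).
have b'a : induced_assigning (product_left B b) = alpha.
  by rewrite halpha; apply/ffunP => X; rewrite !ffunE sum_product_left.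
by rewrite (P_counts _ _ b'0 b'a) (F_counts _ _ b'0 b'a).
Qed.
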